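(* Let $\mathcal{A}$ be a category with bifunctors $\oplus,\otimes:\mathcal{A}\times\mathcal{A}\to\mathcal{A}$ and natural isomorphisms $a^+_{X,Y,Z}:X\oplus(Y\oplus Z)\to(X\oplus Y)\oplus Z$, $c_{A,B}:A\otimes B\to B\otimes A$, $\mathfrak{L}_{A,X,Y}:A\otimes(X\oplus Y)\to(A\otimes X)\oplus(A\otimes Y)$ and $\mathfrak{R}_{X,Y,A}:(X\oplus Y)\otimes A\to(X\otimes A)\oplus(Y\otimes A)$ (as in the data of a braided Ann-category), such that for all objects $A,X,Y$ $$\mathfrak{R}_{X,Y,A}\circ c_{A,X\oplus Y}=(c_{A,X}\oplus c_{A,Y})\circ\mathfrak{L}_{A,X,Y}.$$ If, for every object $A$, the functor $(L^A,\breve{L}^A)$ is compatible with the associativity constraint $a^+$, then, for every object $A$, the functor $(R^A,\breve{R}^A)$ is compatible with $a^+$. Respectively, if, for every object $A$, $(R^A,\breve{R}^A)$ is compatible with $a^+$, then, for every object $A$, $(L^A,\breve{L}^A)$ is compatible with $a^+$.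
   Context: For an object $A$: $L^A=A\otimes-$ with $\breve{L}^A_{X,Y}=\mathfrak{L}_{A,X,Y}$, and $R^A=-\otimes A$ with $\breve{R}^A_{X,Y}=\mathfrak{R}_{X,Y,A}$. Write $AX$ for $A\otimes X$. $(L^A,\breve{L}^A)$ is compatible with $a^+$ if for all $X,Y,Z$ $$(\mathfrak{L}_{A,X,Y}\oplus \mathrm{id}_{AZ})\circ\mathfrak{L}_{A,X\oplus Y,Z}\circ(\mathrm{id}_A\otimes a^+_{X,Y,Z})=a^+_{AX,AY,AZ}\circ(\mathrm{id}_{AX}\oplus\mathfrak{L}_{A,Y,Z})\circ\mathfrak{L}_{A,X,Y\oplus Z}.$$ $(R^A,\breve{R}^A)$ is compatible with $a^+$ if for all $X,Y,Z$ $$(\mathfrak{R}_{X,Y,A}\oplus \mathrm{id}_{ZA})\circ\mathfrak{R}_{X\oplus Y,Z,A}\circ(a^+_{X,Y,Z}\otimes \mathrm{id}_A)=a^+_{XA,YA,ZA}\circ(\mathrm{id}_{XA}\oplus\mathfrak{R}_{Y,Z,A})\circ\mathfrak{R}_{X,Y\oplus Z,A}.$$ *)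

(* Defs.v *)
Set Implicit Arguments.
Unset Strict Implicit.
Unset Printing Implicit Defensive.

Record Category := MkCategory {
  Obj :> Type;
  Hom : Obj -> Obj -> Type;
  idm : forall X, Hom X X;
  comp : forall X Y Z, Hom Y Z -> Hom X Y -> Hom X Z;
  comp_idl : forall X Y (f : Hom X Y), comp (idm Y) f = f;
  comp_idr : forall X Y (f : Hom X Y), comp f (idm X) = f;
  comp_assoc : forall X Y Z W (h : Hom Z W) (g : Hom Y Z) (f : Hom X Y),
    comp h (comp g f) = comp (comp h g) f
}.
Arguments Hom {_} _ _.
Arguments idm {_} X.
Arguments comp {_ X Y Z} g f.

Declare Scope cat_scope.
Delimit Scope cat_scope with cat.
Open Scope cat_scope.
Notation "g ∘ f" := (comp g f) (at level 40, left associativity) : cat_scope.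

Record Functor (C D : Category) := MkFunctor {
  fobj :> C -> D;
  fmap : forall X Y, Hom X Y -> Hom (fobj X) (fobj Y);
  fmap_id : forall X, fmap (idm X) = idm (fobj X);
  fmap_comp : forall X Y Z (g : Hom Y Z) (f : Hom X Y),
    fmap (g ∘ f) = fmap g ∘ fmap f
}.
Arguments fmap {C D} F {X Y} f : rename.
Arguments fmap_id {C D} F X : rename.
Arguments fmap_comp {C D} F {X Y Z} g f : rename.

Record NatIso (C D : Category) (F G : Functor C D) := MkNatIso {
  component :> forall X, Hom (F X) (G X);
  component_inv : forall X, Hom (G X) (F X);
  component_invl : forall X, component_inv X ∘ component X = idm (F X);
  component_invr : forall X, component X ∘ component_inv X = idm (G X);
  component_nat : forall X Y (f : Hom X Y),
    component Y ∘ fmap F f = fmap G f ∘ component X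
}.
Arguments component {C D F G} e X : rename.
Arguments component_inv {C D F G} e X : rename.
Arguments component_invl {C D F G} e X : rename.
Arguments component_invr {C D F G} e X : rename.
Arguments component_nat {C D F G} e {X Y} f : rename.

Definition prodC (C D : Category) : Category.
Proof.
refine (@MkCategory (C * D)
  (fun X Y => (Hom (fst X) (fst Y) * Hom (snd X) (snd Y))%type)
  (fun X => (idm (fst X), idm (snd X)))
  (fun X Y Z g f => (fst g ∘ fst f, snd g ∘ snd f)) _ _ _).
- intros X Y [f g]; cbn; now rewrite !comp_idl.
- intros X Y [f g]; cbn; now rewrite !comp_idr.
- intros X Y Z W h g f; cbn; now rewrite !comp_assoc.
Defined.

Definition idF (C : Category) : Functor C C :=
  @MkFunctor C C (fun X => X) (fun X Y f => f)
    (fun X => eq_refl) (fun X Y Z g f => eq_refl).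

Definition constF (C D : Category) (A : D) : Functor C D :=
  @MkFunctor C D (fun _ => A) (fun X Y f => idm A)
    (fun X => eq_refl) (fun X Y Z g f => eq_sym (comp_idl (idm A))).
Arguments constF {C D} A.

Definition fstF (C D : Category) : Functor (prodC C D) C :=
  @MkFunctor (prodC C D) C (fun X => fst X) (fun X Y f => fst f)
    (fun X => eq_refl) (fun X Y Z g f => eq_refl).

Definition sndF (C D : Category) : Functor (prodC C D) D :=
  @MkFunctor (prodC C D) D (fun X => snd X) (fun X Y f => snd f)
    (fun X => eq_refl) (fun X Y Z g f => eq_refl).

Arguments fstF {C D}.
Arguments sndF {C D}.

Definition compF (C D E : Category) (G : Functor D E) (F : Functor C D) :
  Functor C E.
Proof.
refine (@MkFunctor C E (fun X => G (F X)) (fun X Y f => fmap G (fmap F f)) _ _).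
- intros X; now rewrite !fmap_id.
- intros X Y Z g f; now rewrite !fmap_comp.
Defined.

Definition pairF (C D E : Category) (F : Functor C D) (G : Functor C E) :
  Functor C (prodC D E).
Proof.
refine (@MkFunctor C (prodC D E) (fun X => (F X, G X))
          (fun X Y f => (fmap F f, fmap G f)) _ _).
- intros X; cbn; now rewrite !fmap_id.
- intros X Y Z g f; cbn; now rewrite !fmap_comp.
Defined.

Definition Bifunctor (C : Category) := Functor (prodC C C) C.

Definition op_obj (C : Category) (T : Bifunctor C) (X Y : C) : C := T (X, Y).

Definition op_mor (C : Category) (T : Bifunctor C) (X X' Y Y' : C)
    (f : Hom X X') (g : Hom Y Y') : Hom (op_obj T X Y) (op_obj T X' Y') :=
  @fmap _ _ T (X, Y) (X', Y') (f, g).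

(* The functor V |-> T (F V, G V). *)
Definition opF (B C : Category) (T : Bifunctor C) (F G : Functor B C) :
  Functor B C := compF T (pairF F G).

(* The triple (X, Y, Z) is ((X, Y), Z). *)
Definition prod3 (C : Category) : Category := prodC (prodC C C) C.
Definition pr1 (C : Category) : Functor (prod3 C) C := compF fstF fstF.
Definition pr2 (C : Category) : Functor (prod3 C) C := compF sndF fstF.
Definition pr3 (C : Category) : Functor (prod3 C) C := sndF.

Section Constraints.
Variables (C : Category) (plus tens : Bifunctor C).

(* X ⊕ (Y ⊕ Z) -> (X ⊕ Y) ⊕ Z, at (X, Y, Z) *)
Definition Associativity : Type :=
  NatIso (opF plus (pr1 C) (opF plus (pr2 C) (pr3 C)))
         (opF plus (opF plus (pr1 C) (pr2 C)) (pr3 C)).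

(* A ⊗ B -> B ⊗ A, at (A, B) *)
Definition Commutativity : Type :=
  NatIso (opF tens (@fstF C C) (@sndF C C)) (opF tens (@sndF C C) (@fstF C C)).

(* A ⊗ (X ⊕ Y) -> (A ⊗ X) ⊕ (A ⊗ Y), at (A, X, Y) *)
Definition LeftDistributivity : Type :=
  NatIso (opF tens (pr1 C) (opF plus (pr2 C) (pr3 C)))
         (opF plus (opF tens (pr1 C) (pr2 C)) (opF tens (pr1 C) (pr3 C))).

(* (X ⊕ Y) ⊗ A -> (X ⊗ A) ⊕ (Y ⊗ A), at (X, Y, A) *)
Definition RightDistributivity : Type :=
  NatIso (opF tens (opF plus (pr1 C) (pr2 C)) (pr3 C))
         (opF plus (opF tens (pr1 C) (pr3 C)) (opF tens (pr2 C) (pr3 C))).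

(* F (X ⊕ Y) -> F X ⊕ F Y, at (X, Y) *)
Definition AdditivityConstraint (F : Functor C C) : Type :=
  NatIso (compF F (opF plus (@fstF C C) (@sndF C C)))
         (opF plus (compF F (@fstF C C)) (compF F (@sndF C C))).

Definition leftF (A : C) : Functor C C := opF tens (constF A) (idF C).
Definition rightF (A : C) : Functor C C := opF tens (idF C) (constF A).

Definition breveL (L : LeftDistributivity) (A : C) :
  AdditivityConstraint (leftF A).
Proof.
refine (@MkNatIso _ _ (compF (leftF A) (opF plus (@fstF C C) (@sndF C C)))
  (opF plus (compF (leftF A) (@fstF C C)) (compF (leftF A) (@sndF C C)))
  (fun V => L (A, fst V, snd V))
  (fun V => component_inv L (A, fst V, snd V)) _ _ _).
- intros V; exact (component_invl L (A, fst V, snd V)).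
- intros V; exact (component_invr L (A, fst V, snd V)).
- intros V W f.
  exact (@component_nat _ _ _ _ L (A, fst V, snd V) (A, fst W, snd W)
           (idm A, fst f, snd f)).
Defined.

Definition breveR (R : RightDistributivity) (A : C) :
  AdditivityConstraint (rightF A).
Proof.
refine (@MkNatIso _ _ (compF (rightF A) (opF plus (@fstF C C) (@sndF C C)))
  (opF plus (compF (rightF A) (@fstF C C)) (compF (rightF A) (@sndF C C)))
  (fun V => R (fst V, snd V, A))
  (fun V => component_inv R (fst V, snd V, A)) _ _ _).
- intros V; exact (component_invl R (fst V, snd V, A)).
- intros V; exact (component_invr R (fst V, snd V, A)).
- intros V W f.
  exact (@component_nat _ _ _ _ R (fst V, snd V, A) (fst W, snd W, A)
           (fst f, snd f, idm A)).
Defined.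

Definition compatible_assoc (a : Associativity) (F : Functor C C)
    (b : AdditivityConstraint F) : Prop :=
  forall X Y Z : C,
    op_mor plus (b (X, Y)) (idm (F Z))
      ∘ b (op_obj plus X Y, Z)
      ∘ fmap F (a (X, Y, Z))
    = a (F X, F Y, F Z)
      ∘ op_mor plus (idm (F X)) (b (Y, Z))
      ∘ b (X, op_obj plus Y Z).

End Constraints.

Arguments breveL {C plus tens} L A.
Arguments breveR {C plus tens} R A.
Arguments compatible_assoc {C plus} a F b.
Arguments leftF {C} tens A.
Arguments rightF {C} tens A.

Fact compatible_assoc_leftE (C : Category) (plus tens : Bifunctor C)
    (a : Associativity plus) (L : LeftDistributivity plus tens) (A : C) :
  compatible_assoc a (leftF tens A) (breveL L A) =
  forall X Y Z : C,
    op_mor plus (L (A, X, Y)) (idm (op_obj tens A Z))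
      ∘ L (A, op_obj plus X Y, Z)
      ∘ op_mor tens (idm A) (a (X, Y, Z))
    = a (op_obj tens A X, op_obj tens A Y, op_obj tens A Z)
      ∘ op_mor plus (idm (op_obj tens A X)) (L (A, Y, Z))
      ∘ L (A, X, op_obj plus Y Z).
Proof. reflexivity. Qed.

Fact compatible_assoc_rightE (C : Category) (plus tens : Bifunctor C)
    (a : Associativity plus) (R : RightDistributivity plus tens) (A : C) :
  compatible_assoc a (rightF tens A) (breveR R A) =
  forall X Y Z : C,
    op_mor plus (R (X, Y, A)) (idm (op_obj tens Z A))
      ∘ R (op_obj plus X Y, Z, A)
      ∘ op_mor tens (a (X, Y, Z)) (idm A)
    = a (op_obj tens X A, op_obj tens Y A, op_obj tens Z A)
      ∘ op_mor plus (idm (op_obj tens X A)) (R (Y, Z, A))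
      ∘ R (X, op_obj plus Y Z, A).
Proof. reflexivity. Qed.

(* Main.v *)
(** The hypothesis relating [L] and [R] says that the natural isomorphism
    [c (A, -)], from A ⊗ - to - ⊗ A, respects the additivity constraints of
    these two functors. Such an isomorphism [t] from F to G carries both sides
    of the compatibility square of F to those of G, through [t] at X ⊕ (Y ⊕ Z)
    and (tX ⊕ tY) ⊕ tZ; cancelling these isomorphisms gives both
    implications. *)

Require Import Defs.

Set Implicit Arguments.
Unset Strict Implicit.

(** A one-sided inverse [s] is enough to cancel [t]: here [t] is split epi, in the next lemma split
    mono. *)
Lemma comp_cancel_r (C : Category) (X Y Z : C) (t : Hom X Y) (s : Hom Y X)
    (f g : Hom Y Z) :
  t ∘ s = idm Y -> f ∘ t = g ∘ t -> f = g.
Proof.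
intros ts fg.
rewrite <- (comp_idr f), <- (comp_idr g), <- ts, !comp_assoc.
now rewrite fg.
Qed.

Lemma comp_cancel_l (C : Category) (X Y Z : C) (t : Hom Y Z) (s : Hom Z Y)
    (f g : Hom X Y) :
  s ∘ t = idm Y -> t ∘ f = t ∘ g -> f = g.
Proof.
intros st fg.
rewrite <- (comp_idl f), <- (comp_idl g), <- st, <- !comp_assoc.
now rewrite fg.
Qed.

(** Three commuting squares side by side, with vertical arrows [t0], ..., [t3]. Each side of the
    compatibility equation is a composite of three arrows, so this shape serves for both. *)
Lemma paste_squares (C : Category) (X0 X1 X2 X3 Y0 Y1 Y2 Y3 : C)
    (p : Hom Y2 Y3) (q : Hom Y1 Y2) (r : Hom Y0 Y1)
    (p' : Hom X2 X3) (q' : Hom X1 X2) (r' : Hom X0 X1)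
    (t0 : Hom X0 Y0) (t1 : Hom X1 Y1) (t2 : Hom X2 Y2) (t3 : Hom X3 Y3) :
  p ∘ t2 = t3 ∘ p' -> q ∘ t1 = t2 ∘ q' -> r ∘ t0 = t1 ∘ r' ->
  p ∘ q ∘ r ∘ t0 = t3 ∘ (p' ∘ q' ∘ r').
Proof.
intros Hp Hq Hr.
rewrite <- (comp_assoc _ r t0), Hr, comp_assoc.
rewrite <- (comp_assoc p q t1), Hq, comp_assoc, Hp.
now rewrite !comp_assoc.
Qed.

Lemma op_mor_id (C : Category) (T : Bifunctor C) (X Y : C) :
  op_mor T (idm X) (idm Y) = idm (op_obj T X Y).
Proof. exact (fmap_id T (X, Y)). Qed.

Lemma op_mor_comp (C : Category) (T : Bifunctor C) (X X' X'' Y Y' Y'' : C)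
    (f' : Hom X' X'') (f : Hom X X') (g' : Hom Y' Y'') (g : Hom Y Y') :
  op_mor T f' g' ∘ op_mor T f g = op_mor T (f' ∘ f) (g' ∘ g).
Proof.
symmetry.
exact (@fmap_comp _ _ T (X, Y) (X', Y') (X'', Y'') (f', g') (f, g)).
Qed.

Lemma op_mor_square (C : Category) (T : Bifunctor C)
    (X0 X1 X2 X3 Y0 Y1 Y2 Y3 : C)
    (f1 : Hom X1 X3) (f2 : Hom X0 X1) (f3 : Hom X2 X3) (f4 : Hom X0 X2)
    (g1 : Hom Y1 Y3) (g2 : Hom Y0 Y1) (g3 : Hom Y2 Y3) (g4 : Hom Y0 Y2) :
  f1 ∘ f2 = f3 ∘ f4 -> g1 ∘ g2 = g3 ∘ g4 ->
  op_mor T f1 g1 ∘ op_mor T f2 g2 = op_mor T f3 g3 ∘ op_mor T f4 g4.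
Proof. intros Hf Hg; now rewrite !op_mor_comp, Hf, Hg. Qed.

Lemma comp_id_swap (C : Category) (X Y : C) (f : Hom X Y) :
  idm Y ∘ f = f ∘ idm X.
Proof. now rewrite comp_idl, comp_idr. Qed.

(** Naturality of [a] at the triple (f, g, h), with the composite functors on triples unfolded by
    conversion. *)
Lemma associativity_nat (C : Category) (plus : Bifunctor C)
    (a : Associativity plus) (X X' Y Y' Z Z' : C)
    (f : Hom X X') (g : Hom Y Y') (h : Hom Z Z') :
  a (X', Y', Z') ∘ op_mor plus f (op_mor plus g h)
  = op_mor plus (op_mor plus f g) h ∘ a (X, Y, Z).
Proof.
exact (@component_nat _ _ _ _ a (X, Y, Z) (X', Y', Z') (f, g, h)).
Qed.

Section Transfer.
Variables (C : Category) (plus : Bifunctor C) (a : Associativity plus).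
Variables (F G : Functor C C).
Variables (bF : AdditivityConstraint plus F) (bG : AdditivityConstraint plus G).

(** The condition on a monoidal transformation for ⊕, without units. *)
Definition additive_nat (t : NatIso F G) : Prop :=
  forall X Y : C,
    bG (X, Y) ∘ t (op_obj plus X Y) = op_mor plus (t X) (t Y) ∘ bF (X, Y).

Variables (t : NatIso F G) (t_add : additive_nat t).

(** From the last arrow to the first, the squares are: additivity of [t] at (X, Y) summed with a
    trivial square on Z, additivity at (X ⊕ Y, Z), and naturality of [t] along [a]. *)
Lemma additive_nat_left_leg (X Y Z : C) :
  op_mor plus (bG (X, Y)) (idm (G Z)) ∘ bG (op_obj plus X Y, Z)
    ∘ fmap G (a (X, Y, Z)) ∘ t (op_obj plus X (op_obj plus Y Z))
  = op_mor plus (op_mor plus (t X) (t Y)) (t Z)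
    ∘ (op_mor plus (bF (X, Y)) (idm (F Z)) ∘ bF (op_obj plus X Y, Z)
       ∘ fmap F (a (X, Y, Z))).
Proof.
refine (paste_squares (t1 := t (op_obj plus (op_obj plus X Y) Z))
          (t2 := op_mor plus (t (op_obj plus X Y)) (t Z)) _ _ _).
- exact (op_mor_square plus (t_add X Y) (comp_id_swap (t Z))).
- exact (t_add (op_obj plus X Y) Z).
- symmetry; exact (component_nat t (a (X, Y, Z))).
Qed.

(** Here naturality of [a] along the components of [t] gives the last square; the other two are
    additivity of [t]. The outer vertical arrows agree with those of the left leg. *)
Lemma additive_nat_right_leg (X Y Z : C) :
  a (G X, G Y, G Z) ∘ op_mor plus (idm (G X)) (bG (Y, Z))
    ∘ bG (X, op_obj plus Y Z) ∘ t (op_obj plus X (op_obj plus Y Z))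
  = op_mor plus (op_mor plus (t X) (t Y)) (t Z)
    ∘ (a (F X, F Y, F Z) ∘ op_mor plus (idm (F X)) (bF (Y, Z))
       ∘ bF (X, op_obj plus Y Z)).
Proof.
refine (paste_squares (t1 := op_mor plus (t X) (t (op_obj plus Y Z)))
          (t2 := op_mor plus (t X) (op_mor plus (t Y) (t Z))) _ _ _).
- exact (associativity_nat a (t X) (t Y) (t Z)).
- exact (op_mor_square plus (comp_id_swap (t X)) (t_add Y Z)).
- exact (t_add X (op_obj plus Y Z)).
Qed.

Lemma compatible_assoc_transfer :
  compatible_assoc a F bF <-> compatible_assoc a G bG.
Proof.
split; intros H X Y Z.
(* From F to G: precompose with the invertible [t] at X ⊕ (Y ⊕ Z), which turns both legs of G into
   legs of F. *)
- apply (comp_cancel_r (component_invr t (op_obj plus X (op_obj plus Y Z)))).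
  etransitivity; [exact (additive_nat_left_leg X Y Z) |].
  etransitivity; [| symmetry; exact (additive_nat_right_leg X Y Z)].
  exact (f_equal _ (H X Y Z)).
(* From G to F: cancel (tX ⊕ tY) ⊕ tZ on the left; bifunctoriality of ⊕ builds its inverse from
   those of the components. *)
- assert (inv : op_mor plus (op_mor plus (component_inv t X) (component_inv t Y))
                  (component_inv t Z)
                ∘ op_mor plus (op_mor plus (t X) (t Y)) (t Z) = idm _).
  { rewrite !op_mor_comp, !component_invl, !op_mor_id; reflexivity. }
  apply (comp_cancel_l inv).
  etransitivity; [symmetry; exact (additive_nat_left_leg X Y Z) |].
  etransitivity; [| exact (additive_nat_right_leg X Y Z)].
  exact (f_equal (fun u => u ∘ t (op_obj plus X (op_obj plus Y Z))) (H X Y Z)).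
Qed.

End Transfer.

(** Naturality in the free variable is that of [c] along the pair ([idm A], f). *)
Definition commutativity_at (C : Category) (tens : Bifunctor C)
    (c : Commutativity tens) (A : C) : NatIso (leftF tens A) (rightF tens A) :=
  @MkNatIso _ _ (leftF tens A) (rightF tens A)
    (fun X => c (A, X)) (fun X => component_inv c (A, X))
    (fun X => component_invl c (A, X)) (fun X => component_invr c (A, X))
    (fun X Y f => @component_nat _ _ _ _ c (A, X) (A, Y) (idm A, f)).

Unset Implicit Arguments.
Set Strict Implicit.

Theorem proposition3p2 :
  forall (C : Category) (plus tens : Bifunctor C)
    (a : Associativity plus)
    (c : Commutativity tens)
    (L : LeftDistributivity plus tens)
    (R : RightDistributivity plus tens)
    (hcLR : forall A X Y : C,
       R (X, Y, A) ∘ c (A, op_obj plus X Y)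
       = op_mor plus (c (A, X)) (c (A, Y)) ∘ L (A, X, Y)),
    ((forall A : C, compatible_assoc a (leftF tens A) (breveL L A)) ->
     (forall A : C, compatible_assoc a (rightF tens A) (breveR R A)))
    /\
    ((forall A : C, compatible_assoc a (rightF tens A) (breveR R A)) ->
     (forall A : C, compatible_assoc a (leftF tens A) (breveL L A))).
Proof.
intros C plus tens a c L R hcLR.
assert (transfer : forall A, compatible_assoc a (leftF tens A) (breveL L A)
                         <-> compatible_assoc a (rightF tens A) (breveR R A)).
{ intros A.
  (* [hcLR A] is, up to conversion, the additivity of c (A, -) with respect to [breveL L A] and
     [breveR R A]. *)
  exact (@compatible_assoc_transfer C plus a _ _ (breveL L A) (breveR R A)
           (commutativity_at c A) (hcLR A)). }
split; intros H A; apply transfer, H.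
Qed.
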